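(* Let $M$ be a complex square matrix. Then $M$ is duodiagonalizable if and only if $M$ is diagonalizable with a symmetric or c-symmetric spectrum. If additionally $M$ is traceless, then $M$ is duodiagonalizable if and only if $M$ is similar to an antipersymmetric diagonal matrix.
   Context: A matrix is antidiagonal if its only nonzero entries are at positions $(i,n+1-i)$, antidiagonalizable if it is similar to an antidiagonal matrix, and duodiagonalizable if it is both diagonalizable and antidiagonalizable. The spectrum is the multiset of eigenvalues with algebraic multiplicity; it is symmetric if it is invariant, with multiplicities, under multiplication by $-1$. The spectrum $\mathcal S$ of a matrix of odd size is c-symmetric if there is $c\in\mathcal S$ such that $\mathcal S\setminus\{c\}$ (one copy removed) is symmetric. A diagonal matrix $\mathrm{diag}(d_1,\dots,d_n)$ is antipersymmetric if $d_{n+1-i}=-d_i$ for all $i$. *)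

(* Defs.v *)
From mathcomp Require Import all_boot all_order all_algebra.
From mathcomp Require Import finmap multiset complex reals.

Set Implicit Arguments.
Unset Strict Implicit.
Unset Printing Implicit Defensive.

Import Order.TTheory GRing.Theory Num.Theory.
Local Open Scope ring_scope.

(* Indices start at 0, so [rev_ord i] is n+1-i in 1-based indexing. *)
Definition is_antidiag_mx (F : fieldType) (n : nat) (A : 'M[F]_n) : bool :=
  [forall i, forall j, (A i j != 0) ==> (j == rev_ord i)].

Definition antidiagonalizable (F : fieldType) (n : nat) (M : 'M[F]_n) : Prop :=
  similar_in_to unitmx M (@is_antidiag_mx F n).

Definition duodiagonalizable (F : fieldType) (n : nat) (M : 'M[F]_n) : Prop :=
  diagonalizable M /\ antidiagonalizable M.

Definition is_antipersym_diag_mx (F : fieldType) (n : nat) (D : 'M[F]_n) : bool :=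
  is_diag_mx D && [forall i, D (rev_ord i) (rev_ord i) == - D i i].

(* [seq_mset] forgets the arbitrary order in which the roots are listed; by
   [spectrum_mup] below, [spectrum M x] is the algebraic multiplicity of [x]. *)
Definition spectrum (F : closedFieldType) (n : nat) (M : 'M[F]_n) : {mset F}%mset :=
  seq_mset (sval (closed_field_poly_normal (char_poly M))).

Lemma char_poly_spectrum (F : closedFieldType) (n : nat) (M : 'M[F]_n) :
  char_poly M = \prod_(x <- spectrum M) ('X - x%:P).
Proof.
rewrite (perm_big _ (perm_eq_seq_mset _)) /=.
case: closed_field_poly_normal => s /=.
by rewrite (monicP (char_poly_monic M)) scale1r.
Qed.

Lemma spectrum_mup (F : closedFieldType) (n : nat) (M : 'M[F]_n) (x : F) :
  spectrum M x = mup x (char_poly M).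
Proof.
rewrite mset_seqE; case: closed_field_poly_normal => s /= ->.
by rewrite (monicP (char_poly_monic M)) scale1r mu_prod_XsubC.
Qed.

Definition symmetric_mset (V : zmodType) (S : {mset V}%mset) : Prop :=
  forall x : V, S (- x) = S x.

Definition symmetric_spectrum (F : closedFieldType) (n : nat) (M : 'M[F]_n) : Prop :=
  symmetric_mset (spectrum M).

Definition c_symmetric_spectrum (F : closedFieldType) (n : nat) (M : 'M[F]_n) : Prop :=
  odd n /\ exists2 c, c \in spectrum M & symmetric_mset (spectrum M `\ c)%mset.

(* Main.v *)
(** An antidiagonal matrix of even size is conjugate to its opposite by a
    diagonal matrix of signs, so its spectrum is symmetric; in odd size the
    middle row splits off the eigenvalue c. Conversely, a symmetric or
    c-symmetric spectrum can be listed as x_1, ..., x_k, (c), -x_k, ..., -x_1,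
    and each block diag(x, -x) is similar to the antidiagonal block with both
    entries x. The trace of such an arrangement is its middle entry, which
    therefore vanishes for a traceless matrix. *)
Require Import Defs.
From mathcomp Require Import all_boot all_order all_fingroup all_algebra.
From mathcomp Require Import finmap multiset complex reals.
From mathcomp Require Import zify ring.

Set Implicit Arguments.
Unset Strict Implicit.
Unset Printing Implicit Defensive.

Import Order.TTheory GRing.Theory Num.Theory.
Local Open Scope ring_scope.
Local Open Scope complex_scope.

(** * Similarity, characteristic polynomials and spectra *)

(** With [P *m M = B *m P] in place of an explicit inverse, similarities compose by associativity
    alone. *)
Lemma similar_in_toP (F : fieldType) n (M : 'M[F]_n) (S : pred 'M[F]_n) :
  similar_in_to unitmx M S <->
  exists2 P, P \in unitmx & exists2 B, S B & P *m M = B *m P.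
Proof.
split=> [[P Pu SM] | [P Pu [B SB eqPM]]]; exists P => //.
  exists (conjmx P M); first exact: SM.
  by rewrite conjumx // mulmxKV.
by rewrite /similar_to conjumx // eqPM mulmxK.
Qed.

Lemma similar_in_to_trans (F : fieldType) n (P A B : 'M[F]_n) (S : pred 'M[F]_n) :
  P \in unitmx -> P *m A = B *m P ->
  similar_in_to unitmx B S -> similar_in_to unitmx A S.
Proof.
move=> Pu PA /similar_in_toP[Q Qu [C SC QB]]; apply/similar_in_toP.
exists (Q *m P); first by rewrite unitmx_mul Qu.
by exists C => //; rewrite -mulmxA PA !mulmxA QB.
Qed.

Lemma is_antidiag_mxP (F : fieldType) n (A : 'M[F]_n) :
  reflect (forall i j, j != rev_ord i -> A i j = 0) (is_antidiag_mx A).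
Proof.
apply: (iffP forallP) => [A0 i j | A0 i].
  by move/negPf=> neq; have /forallP/(_ j) := A0 i; rewrite neq implybF => /negPn/eqP.
by apply/forallP=> j; apply/implyP; apply: contraNT => /A0 ->.
Qed.

(** Over polynomials [P] still intertwines the two characteristic matrices; its determinant is a
    nonzero constant and cancels. *)
Lemma char_poly_similar (F : fieldType) n (P A B : 'M[F]_n) :
  P \in unitmx -> P *m A = B *m P -> char_poly A = char_poly B.
Proof.
move=> Pu PA; pose Q := map_mx polyC P.
have Q0 : \det Q != 0 by rewrite /Q det_map_mx polyC_eq0 -unitfE -unitmxE.
apply: (mulfI Q0); rewrite [RHS]mulrC -!det_mulmx /char_poly_mx.
by rewrite mulmxBr mulmxBl scalar_mxC -!map_mxM PA.
Qed.

Lemma perm_spectrum (F : closedFieldType) n (M : 'M[F]_n) s :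
  char_poly M = \prod_(x <- s) ('X - x%:P) -> perm_eq (spectrum M) s.
Proof. by rewrite char_poly_spectrum => /prod_XsubC_eq. Qed.

Lemma size_spectrum (F : closedFieldType) n (M : 'M[F]_n) : size (spectrum M) = n.
Proof.
apply: succn_inj; rewrite -(size_char_poly M) char_poly_spectrum.
by rewrite size_prod_XsubC.
Qed.

(** * Spectra of antidiagonal matrices *)

(* Conjugating by the diagonal matrix of these signs negates an antidiagonal
   matrix of even size. *)
Definition half_sign (R : pzRingType) n (i : 'I_n) : R := (-1) ^+ (rev_ord i < i)%N.

Lemma half_signM (R : pzRingType) n (i : 'I_n) : half_sign R i * half_sign R i = 1.
Proof. by rewrite -expr2 sqrr_sign. Qed.

Lemma half_sign_rev (R : pzRingType) n (i : 'I_n) :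
  rev_ord i != i -> half_sign R (rev_ord i) = - half_sign R i.
Proof.
move=> neq; rewrite /half_sign rev_ordK.
have {neq} : rev_ord i != i :> nat by [].
by case: ltngtP => //; rewrite ?expr1 ?expr0 ?opprK.
Qed.

Lemma rev_ord_neq n (i : 'I_n) : ~~ odd n -> rev_ord i != i.
Proof.
by move=> n_even; rewrite -val_eqE /=; move: n_even (ltn_ord i); lia.
Qed.

(** With $E$ the sign matrix, $E^2 = 1$ and $-X - A = -E(X - A)E$; the determinant of the right side
    gains only the factor $(-1)^n = 1$. *)
Lemma char_poly_antidiag_even (F : fieldType) n (A : 'M[F]_n) :
  ~~ odd n -> is_antidiag_mx A -> char_poly A \Po - 'X = char_poly A.
Proof.
move=> n_even /is_antidiag_mxP Aanti.
pose E : 'M[{poly F}]_n := diag_mx (\row_i half_sign _ i).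
have EE : E *m E = 1%:M.
  rewrite mulmx_diag -diag_const_mx; congr diag_mx.
  by apply/rowP=> i; rewrite !mxE half_signM.
rewrite /char_poly -det_map_mx.
have -> : map_mx (comp_poly (- 'X)) (char_poly_mx A) = - (E *m char_poly_mx A *m E).
  apply/matrixP=> i j; rewrite mul_mx_diag mul_diag_mx !mxE.
  rewrite comp_polyB comp_polyC rmorphMn /= comp_polyX.
  have [-> | neq_ij] := eqVneq i j.
    (* In even size no index is its own mirror image, so [A] has zero diagonal. *)
    rewrite Aanti ?(eq_sym _ (rev_ord _)) ?rev_ord_neq //= !mulr1n polyC0 !subr0.
    by rewrite mulrAC half_signM mul1r.
  rewrite /= !mulr0n !sub0r; have [-> | neq] := eqVneq j (rev_ord i).
    rewrite half_sign_rev ?rev_ord_neq // mulrN mulrN opprK mulNr mulrAC.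
    by rewrite half_signM mul1r.
  by rewrite Aanti // oppr0 mulr0 mul0r oppr0.
rewrite -scaleN1r detZ !det_mulmx (mulrAC (\det E)) -[\det E * _]det_mulmx EE det1.
by rewrite mul1r -signr_odd (negPf n_even) expr0 mul1r.
Qed.

Lemma symmetric_spectrum_antidiag_even (F : closedFieldType) n (A : 'M[F]_n) :
  ~~ odd n -> is_antidiag_mx A -> symmetric_spectrum A.
Proof.
move=> n_even Aanti.
have : perm_eq (spectrum A) [seq - x | x <- spectrum A].
  apply: perm_spectrum; rewrite -(char_poly_antidiag_even n_even Aanti).
  rewrite char_poly_spectrum rmorph_prod /= big_map.
  under eq_bigr do rewrite comp_polyB comp_polyX comp_polyC -opprD.
  under eq_bigr do rewrite -mulN1r.
  rewrite big_split big_const_seq count_predT iter_mulr_1 /= size_spectrum.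
  rewrite -signr_odd (negPf n_even) expr0 mul1r.
  by apply: eq_bigr => x _; rewrite polyCN opprK.
move=> /seq.permP eqS x; rewrite -!count_mem_mset (eqS (pred1 (- x))) count_map.
by apply: eq_count => y /=; rewrite eqr_opp.
Qed.

(** Row [m] of the characteristic matrix vanishes off the diagonal, so the Laplace expansion along
    it has one term. *)
Lemma char_poly_antidiag_odd (F : fieldType) n (A : 'M[F]_n.+1) (m : 'I_n.+1) :
  rev_ord m = m -> is_antidiag_mx A ->
  char_poly A = ('X - (A m m)%:P) * char_poly (row' m (col' m A)).
Proof.
move=> rev_m /is_antidiag_mxP Aanti.
rewrite /char_poly (expand_det_row _ m) (bigD1 m) //= big1 ?addr0.
  rewrite !mxE eqxx mulr1n /cofactor row'_col'_char_poly_mx.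
  by rewrite -signr_odd addnn odd_double mul1r.
move=> j neq_jm; rewrite !mxE eq_sym (negPf neq_jm) Aanti ?rev_m //.
by rewrite subrr mul0r.
Qed.

Lemma is_antidiag_minor (F : fieldType) n (A : 'M[F]_n.+1) (m : 'I_n.+1) :
  rev_ord m = m -> is_antidiag_mx A -> is_antidiag_mx (row' m (col' m A)).
Proof.
move=> rev_m /is_antidiag_mxP Aanti; apply/is_antidiag_mxP => i j neq.
rewrite !mxE Aanti //; apply: contra neq; rewrite -!val_eqE /= /bump.
by move/(congr1 val): rev_m => /=; move: (ltn_ord i) (ltn_ord j); lia.
Qed.

Lemma spectrum_antidiag (F : closedFieldType) n (A : 'M[F]_n) :
  is_antidiag_mx A -> symmetric_spectrum A \/ c_symmetric_spectrum A.
Proof.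
move=> Aanti; have [n_odd | n_even] := boolP (odd n); last first.
  by left; apply: symmetric_spectrum_antidiag_even.
right; split=> //; case: n => // n in A Aanti n_odd *.
have lt_mid : (n./2 < n.+1)%N by lia.
pose m := Ordinal lt_mid.
have rev_m : rev_ord m = m by apply: val_inj => /=; move: n_odd => /=; lia.
have eqS : perm_eq (spectrum A) (A m m :: spectrum (row' m (col' m A))).
  apply: perm_spectrum; rewrite big_cons -char_poly_spectrum.
  exact: char_poly_antidiag_odd.
exists (A m m); first by rewrite (perm_mem eqS) mem_head.
(* Here [n] is one less than the size, so [n_odd] says that the minor has even size. *)
have symB := symmetric_spectrum_antidiag_even n_odd (is_antidiag_minor rev_m Aanti).
move=> x; rewrite !msetB1E -!count_mem_mset !(seq.permP eqS) /= !count_mem_mset.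
by rewrite !(eq_sym (A m m)) !addKn; apply: symB.
Qed.

(** * From diagonal to antidiagonal matrices *)

Lemma similar_diag_antidiag (F : numFieldType) n (d : 'rV[F]_n) :
  (forall i, rev_ord i != i -> d 0 (rev_ord i) = - d 0 i) ->
  antidiagonalizable (diag_mx d).
Proof.
move=> d_rev; apply/similar_in_toP.
(* Each pair [{i, rev_ord i}] contributes the block [[1, 1], [1, -1]], which
   conjugates [diag (x, -x)] to [[0, x], [x, 0]]; the middle entry is 2. *)
pose P : 'M[F]_n :=
  \matrix_(i, j) (half_sign F i * (i == j)%:R + (rev_ord i == j)%:R).
pose A : 'M[F]_n := \matrix_(i, j) (half_sign F i * d 0 i * (rev_ord i == j)%:R).
have mid (i : 'I_n) : rev_ord i = i -> half_sign F i = 1.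
  by rewrite /half_sign => ->; rewrite ltnn.
exists P.
  (* The square of [P] has diagonal entries 2, or 4 in the middle, all nonzero in characteristic 0;
     hence [P] is invertible. *)
  suff : P *m P = diag_mx (\row_i (2 + (rev_ord i == i)%:R * 2)).
    move=> /(congr1 determinant); rewrite det_mulmx det_diag => detP.
    rewrite unitmxE unitfE; apply/eqP => P0; move/esym/eqP: detP.
    rewrite P0 mul0r prodf_seq_eq0 => /hasP[i _ /=].
    by rewrite mxE -natrM -natrD pnatr_eq0.
  apply/matrixP=> i j; rewrite !mxE.
  under eq_bigr => k _ do rewrite mxE mulrDl -mulrA.
  rewrite big_split /= -big_distrr /=.
  have sum_eq (x : 'I_n) (G : 'I_n -> F) : \sum_k (x == k)%:R * G k = G x.
    rewrite (bigD1 x) //= eqxx mul1r big1 ?addr0 // => k.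
    by rewrite eq_sym => /negPf->; rewrite mul0r.
  rewrite !sum_eq !mxE rev_ordK mulrDr mulrA half_signM mul1r.
  have [rev_i | rev_i] := eqVneq (rev_ord i) i.
    rewrite !mid ?rev_ordK ?rev_i //.
    by case: eqVneq => _; rewrite ?mulr1n ?mulr0n; ring.
  rewrite half_sign_rev //.
  by case: eqVneq => _; rewrite ?mulr1n ?mulr0n; ring.
exists A.
  by apply/is_antidiag_mxP => i j neq; rewrite mxE eq_sym (negPf neq) mulr0.
apply/matrixP=> i j; rewrite mul_mx_diag !mxE (bigD1 (rev_ord i)) //= big1; last first.
  by move=> k neq; rewrite !mxE eq_sym (negPf neq) mulr0 mul0r.
rewrite !mxE eqxx rev_ordK addr0 mulr1.
have [rev_i | rev_i] := eqVneq (rev_ord i) i.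
  rewrite rev_i !mid //; case: eqVneq => [->|_]; rewrite ?mulr1n ?mulr0n; ring.
rewrite half_sign_rev //; case: (eqVneq i j) => [<- | neq_ij].
  rewrite (negPf rev_i) mulr1n mulr0n; ring.
case: (eqVneq (rev_ord i) j) => [<- | _]; last by rewrite mulr0n; ring.
rewrite ?mulr1n ?mulr0n d_rev // mulr1 mulr0 !add0r addr0 mul1r mulrN mulrAC.
by rewrite half_signM mul1r.
Qed.

(** * Listing a symmetric spectrum antisymmetrically *)

Lemma symmetric_seq_split (F : numFieldType) (s : seq F) :
  (forall x, count_mem (- x) s = count_mem x s) ->
  exists t, perm_eq s (t ++ nseq (odd (size s)) 0 ++ rev [seq - x | x <- t]).
Proof.
have [k] := ubnP (size s); elim: k s => // k IHk [|x s] /=.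
  by move=> _ _; exists [::].
rewrite ltnS => le_sk sym.
(* If the opposite of the head occurs in the tail, remove both and put them at the two ends. *)
have pair s' : perm_eq s (- x :: s') -> exists t,
    perm_eq (x :: s) (t ++ nseq (~~ odd (size s)) 0 ++ rev [seq - x | x <- t]).
  move=> eqs; have szs : size s = (size s').+1 by rewrite (perm_size eqs).
  have [|y|t eqt] := IHk s'; first by rewrite -szs ltnW.
    have := sym y; rewrite !(seq.permP eqs) /= eqr_opp eqr_oppLR.
    by rewrite addnCA => /addnI/addnI.
  exists (x :: t); rewrite /= perm_cons (perm_trans eqs) // szs /= negbK.
  rewrite rev_cons -cats1 !catA perm_sym perm_catC /= perm_cons perm_sym -catA.
  exact: eqt.
have [xs | xNs] := boolP (- x \in s).
  exact: pair (perm_to_rem xs).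
(* A nonzero [x] would be counted at least once while its opposite is not counted at all. *)
have x0 : x = 0.
  apply/eqP; apply: contraNT xNs => x0.
  have := sym x; rewrite eqxx -has_pred1 has_count.
  have /negPf-> : x != - x by rewrite -subr_eq0 opprK -mulr2n mulrn_eq0.
  by rewrite add0n => ->.
rewrite x0 oppr0 in sym xNs.
have [y|t eqt] := IHk s le_sk.
  by have := sym y; rewrite !(eq_sym 0) oppr_eq0 => /addnI.
exists t; rewrite x0 /=.
(* Were the tail of odd size, its own splitting would have a middle 0, which could have been paired
   with [x]. *)
have even_s : odd (size s) = false.
  apply: contraNF xNs => odd_s.
  by rewrite (perm_mem eqt) odd_s !mem_cat mem_head orbT.
rewrite even_s /= in eqt *.
by rewrite perm_sym -[0 :: rev _]cat1s perm_catCA /= perm_cons perm_sym.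
Qed.

(** The reverse of [u] and its entrywise opposite differ at most in the block coming from [c], whose
    only possible index is the excluded middle one. *)
Lemma nth_antipalindrome (V : zmodType) (t c : seq V) (i : nat) :
  let u := t ++ c ++ rev [seq - x | x <- t] in
  (size c <= 1)%N -> (i < size u)%N -> (size u - i.+1)%N != i ->
  nth 0 u (size u - i.+1) = - nth 0 u i.
Proof.
move=> u le_c1 lt_iu neq_i.
have nth_opp (v : seq V) j : nth 0 [seq - x | x <- v] j = - nth 0 v j.
  have [lt_j | le_j] := ltnP j (size v); first exact: nth_map.
  by rewrite !nth_default ?size_map ?oppr0.
rewrite -nth_rev // -nth_opp.
rewrite /u !rev_cat revK !map_cat map_rev (mapK (@opprK V)) -catA !nth_cat.
rewrite !size_map !size_rev; case: ltnP => // le_ti; case: ltnP => // lt_ic.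
case/eqP: neq_i; move: lt_iu; rewrite /u !size_cat size_rev size_map.
by move: le_c1 le_ti lt_ic; move: (size c) (size t) => k l; lia.
Qed.

(** * Diagonal forms with antisymmetric entries *)

Lemma perm_spectrum_diag (F : closedFieldType) n (d : 'rV[F]_n) :
  perm_eq (spectrum (diag_mx d)) [tuple d 0 i | i < n].
Proof.
apply: perm_spectrum; rewrite char_poly_trig ?diag_mx_is_trig // big_tuple.
by apply: eq_bigr => i _; rewrite mxE eqxx mulr1n tnth_mktuple.
Qed.

Lemma similar_diag_perm (F : fieldType) n (d : 'rV[F]_n) (u : seq F) :
  perm_eq u [tuple d 0 i | i < n] ->
  exists2 P, P \in unitmx & P *m diag_mx d = diag_mx (\row_i nth 0 u i) *m P.
Proof.
case/tuple_permP=> p ->; exists (perm_mx p); first exact: unitmx_perm.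
apply/matrixP=> i j; rewrite mul_mx_diag mul_diag_mx !mxE -tnth_nth !tnth_mktuple.
by case: eqP => [->|_]; rewrite ?mul1r ?mulr1 ?mul0r ?mulr0.
Qed.

Lemma spectrum_similar (F : closedFieldType) n (P A B : 'M[F]_n) :
  P \in unitmx -> P *m A = B *m P -> spectrum A = spectrum B.
Proof.
move=> Pu PA; apply/msetP => x.
by rewrite !spectrum_mup (char_poly_similar Pu PA).
Qed.

Lemma symmetric_spectrum_split (F : numClosedFieldType) n (M : 'M[F]_n) :
  symmetric_spectrum M \/ c_symmetric_spectrum M ->
  exists t c, (size c <= 1)%N /\
    perm_eq (spectrum M) (t ++ c ++ rev [seq - x | x <- t]).
Proof.
case=> [sym | [n_odd [c cS sym]]].
  have [|t eqt] := @symmetric_seq_split F (spectrum M).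
    by move=> x; rewrite !count_mem_mset sym.
  by exists t; eexists; split; last exact: eqt; rewrite size_nseq leq_b1.
have eqS : perm_eq (spectrum M) (c :: (spectrum M `\ c)%mset).
  rewrite -{1}(msetB1K cS); apply/allP=> x _ /=; apply/eqP.
  by rewrite !count_mem_mset mset1DE (eq_sym x).
have szS : odd (size (spectrum M)) by rewrite size_spectrum.
have [|t eqt] := @symmetric_seq_split F (spectrum M `\ c)%mset.
  by move=> x; rewrite !count_mem_mset sym.
exists t, [:: c]; split=> //; apply: (perm_trans eqS).
rewrite perm_sym perm_catCA /= perm_cons perm_sym (perm_trans eqt) //.
(* Without [c] the spectrum has even size, so its own middle block is empty. *)
by move: szS; rewrite (perm_size eqS) /= => /negPf->.
Qed.

(** The middle entry is left unconstrained, so that it can hold [c]; a zero trace will determine it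
    later. *)
Lemma diagonalizable_antisymmetric (F : numClosedFieldType) n (M : 'M[F]_n) :
  diagonalizable M -> symmetric_spectrum M \/ c_symmetric_spectrum M ->
  exists2 P, P \in unitmx & exists2 d : 'rV[F]_n,
    P *m M = diag_mx d *m P
    & forall i, rev_ord i != i -> d 0 (rev_ord i) = - d 0 i.
Proof.
case/similar_in_toP=> P Pu [_ /diag_mxP[d ->] PM].
case/symmetric_spectrum_split=> t [c [le_c1]].
rewrite (spectrum_similar Pu PM); set u := _ ++ _ => eqS.
have eqd : perm_eq u [tuple d 0 i | i < n].
  by apply: perm_trans (perm_spectrum_diag d); rewrite perm_sym.
have szu : size u = n by rewrite (perm_size eqd) size_tuple.
have [Q Qu QD] := similar_diag_perm eqd.
exists (Q *m P); first by rewrite unitmx_mul Qu.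
exists (\row_i nth 0 u i); first by rewrite -mulmxA PM !mulmxA QD.
move=> i neq; rewrite !mxE /= -{1}szu nth_antipalindrome ?szu //.
Qed.

Lemma antipersym_of_trace0 (F : numFieldType) n (d : 'rV[F]_n) :
  (forall i, rev_ord i != i -> d 0 (rev_ord i) = - d 0 i) ->
  \tr (diag_mx d) = 0 -> is_antipersym_diag_mx (diag_mx d).
Proof.
move=> d_rev tr0; rewrite /is_antipersym_diag_mx diag_mx_is_diag /=.
apply/forallP=> i; rewrite !mxE !eqxx !mulr1n.
have [rev_i | /d_rev -> //] := eqVneq (rev_ord i) i.
suff di0 : d 0 i = 0 by rewrite rev_i di0 oppr0.
have := tr0; rewrite mxtrace_diag => sum0.
(* Adding the trace to its reversed copy cancels every term except twice the middle one. *)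
have := congr2 +%R sum0 sum0; rewrite {2}(reindex_inj rev_ord_inj) -big_split /=.
rewrite (bigD1 i) //= big1 ?rev_i => [|j neq_ji].
  by rewrite !addr0 -mulr2n => /eqP; rewrite mulrn_eq0 => /eqP.
(* Reversal has at most one fixed index, so [j] is not fixed. *)
rewrite d_rev ?subrr //; apply: contra neq_ji => /eqP rev_j.
apply/eqP/val_inj; move/(congr1 val): rev_i; move/(congr1 val): rev_j => /=.
lia.
Qed.

Theorem corollary5p13 (R : realType) (n : nat) (M : 'M[R[i]]_n) :
  (duodiagonalizable M <->
     diagonalizable M /\ (symmetric_spectrum M \/ c_symmetric_spectrum M)) /\
  (\tr M = 0 ->
     (duodiagonalizable M <->
        similar_in_to unitmx M (@is_antipersym_diag_mx R[i] n))).
Proof.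
have duodiag_spectrum : duodiagonalizable M <->
    diagonalizable M /\ (symmetric_spectrum M \/ c_symmetric_spectrum M).
  split=> [[Mdiag /similar_in_toP[P Pu [A Aanti PM]]] | [Mdiag sym]]; split=> //.
    rewrite /symmetric_spectrum /c_symmetric_spectrum (spectrum_similar Pu PM).
    exact: spectrum_antidiag.
  have [P Pu [d PM d_rev]] := diagonalizable_antisymmetric Mdiag sym.
  exact: similar_in_to_trans Pu PM (similar_diag_antidiag d_rev).
split=> // trM0; split=> [/duodiag_spectrum[Mdiag sym] | ].
  have [P Pu [d PM d_rev]] := diagonalizable_antisymmetric Mdiag sym.
  apply/similar_in_toP; exists P => //; exists (diag_mx d) => //.
  apply: antipersym_of_trace0 => //.
  by rewrite -(mulmxK Pu (diag_mx d)) -PM mxtrace_mulC mulmxA mulVmx // mul1mx.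
case/similar_in_toP=> P Pu [_ /andP[/diag_mxP[d ->] /forallP d_rev] PM].
split.
  by apply: similar_in_to_trans Pu PM _; apply: diagonalizable_diag.
apply: similar_in_to_trans Pu PM _; apply: similar_diag_antidiag => i _.
by have := d_rev i; rewrite !mxE !eqxx !mulr1n => /eqP.
Qed.
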